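(* There is a constant $c > 0$ such that, for all integers $k \geq 2$, $$T_k \leq c\, k^2 \log k.$$
   Context: Write $[n] = \{1, \ldots, n\}$. A $k$-term arithmetic progression in $[n]$ is a set $\{a, a+d, \ldots, a+(k-1)d\} \subseteq [n]$ with $d \geq 1$ an integer. In a coloring of $[n]$, an arithmetic progression is rainbow if its elements all have different colors. For positive integers $t$ and $m$, an equinumerous $t$-coloring of $[tm]$ is a coloring with $t$ colors in which each color is used exactly $m$ times. $T_k$ denotes the smallest positive integer $t$ such that, for every positive integer $m$, every equinumerous $t$-coloring of $[tm]$ contains a rainbow $k$-term arithmetic progression; the asserted bound includes that such a $t$ exists. Logarithms are to base $e$. *)

(* Defs.v *)
From mathcomp Require Import all_boot all_order all_algebra.
From mathcomp Require Import reals exp.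

Set Implicit Arguments.
Unset Strict Implicit.
Unset Printing Implicit Defensive.

(* The interval [n] = {1, ..., n}. *)
Definition interval1 (n : nat) : seq nat := iota 1 n.

Definition arith_prog (k a d : nat) : seq nat := [seq a + i * d | i <- iota 0 k].

Definition is_AP_in (k n : nat) (s : seq nat) : Prop :=
  exists a d, [/\ 0 < d, s = arith_prog k a d & {subset s <= interval1 n}].

(* A coloring of [n] with t colors is represented by a function nat -> 'I_t;
   only its values on [n] are ever used. *)
Definition equinumerous (t m : nat) (col : nat -> 'I_t) : Prop :=
  forall c : 'I_t, count (fun x => col x == c) (interval1 (t * m)) = m.

Definition rainbow (t : nat) (col : nat -> 'I_t) (s : seq nat) : Prop :=
  {in s &, injective col}.

Definition forces_rainbow_AP (k t : nat) : Prop :=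
  forall m : nat, 0 < m ->
  forall col : nat -> 'I_t, equinumerous m col ->
  exists2 s : seq nat, is_AP_in k (t * m) s & rainbow col s.

(* "T_k exists and equals T". Positivity matters: t = 0 admits no coloring
   nat -> 'I_0 and would satisfy forces_rainbow_AP vacuously. *)
Definition is_T (k T : nat) : Prop :=
  [/\ 0 < T, forces_rainbow_AP k T
    & forall t, 0 < t -> forces_rainbow_AP k t -> T <= t].

(* Main.v *)
(* The common differences are restricted to k-rough numbers d <= N = n / 2k,
   i.e. those without prime factor below k. If x = a + i d and y = a + j d, then
   y - x = (j - i) d with 0 < j - i < k, so d is the k-rough part of y - x, and
   (a, d) is determined by (x, y, i). If no progression is rainbow, choosing in
   each a monochromatic pair (x, y) therefore gives
   (n / 2) Phi(N) <= n m k, where Phi(N) counts the k-rough numbers up to N. This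
   bounds t, because Phi(N) >= c N / ln k as soon as N >= C k ln k:

   - Summing von Mangoldt's identity over the k-rough r <= N,
     Phi(N) ln N >= sum_r ln r >= sum_r psi(N / r), with psi restricted to primes
     p >= k; binomial coefficients give psi(y) >= y / 12 for y >= 144 k ln k.
     So Phi(N) ln N >= c N S(x), where S(x) is the sum of 1 / r over the k-rough
     r <= x and x ~ N / (k ln k).
   - Let F(X) be the sum of 1 / s over the k-smooth s <= X. As each integer is a
     smooth times a rough number, ln x <= S(x) F(x). Also
     F(X) <= 20 ln k: the mean of ln s with weights 1 / s is at most
     2 sum_(p < k) ln p / p <= 4 ln k, so by Markov's inequality at least half of
     F(X) comes from s <= k^8. *)
Require Import Defs.
From mathcomp Require Import all_boot all_order all_algebra.
From mathcomp Require Import reals exp.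
From mathcomp Require Import boolp.
From mathcomp Require Import zify ring lra.
Import Order.TTheory GRing.Theory Num.Theory.

Set Implicit Arguments.
Unset Strict Implicit.
Unset Printing Implicit Defensive.

Local Open Scope ring_scope.

(** Reindexing along [h] makes the left sum a subsum of the right one, and the terms left over are
    nonnegative. *)
Lemma ler_sum_inj (R : realType) (I J : eqType) (r : seq I) (s : seq J)
    (P : pred I) (Q : pred J) (h : I -> J) (f : J -> R) :
  uniq r -> uniq s ->
  {in r, forall i, P i -> (h i \in s) && Q (h i)} ->
  {in r &, forall i j, P i -> P j -> h i = h j -> i = j} ->
  (forall j, 0 <= f j) ->
  \sum_(i <- r | P i) f (h i) <= \sum_(j <- s | Q j) f j.
Proof.
move=> ur us hQ hinj f0; pose t := [seq h i | i <- r & P i].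
have ut : uniq t.
  rewrite map_inj_in_uniq ?filter_uniq// => i j.
  by rewrite !mem_filter => /andP[Pi ri] /andP[Pj rj]; apply: hinj.
have tQ j : j \in t -> (j \in s) && Q j.
  by move=> /mapP[i]; rewrite mem_filter => /andP[Pi ri] ->; apply: hQ.
have pt : perm_eq t [seq j <- s | Q j && (j \in t)].
  apply: uniq_perm => // [|j]; first exact: filter_uniq.
  by rewrite mem_filter; case: (boolP (j \in t)) => [/tQ/andP[-> ->]|]; rewrite ?andbF.
rewrite -big_filter -(big_map h xpredT f) (perm_big _ pt)/= big_filter.
by rewrite [leRHS](bigID [in t])/= lerDl sumr_ge0.
Qed.

(** * Elementary estimates for logarithms, harmonic sums and factorials *)

Section NatLogarithm.
Variable R : realType.

Lemma ln_nat_ge0 n : 0 <= ln (n%:R : R).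
Proof. by case: n => [|n]; [rewrite ln0 | rewrite ln_ge0 ?ler1n]. Qed.

Lemma ln_nat_le m n : (m <= n)%N -> ln (m%:R : R) <= ln n%:R.
Proof.
(* At [m = 0] the convention [ln 0 = 0] is what makes the claim true. *)
case: m => [|m] mn; first by rewrite ln0 ?ln_nat_ge0.
by rewrite ler_ln ?posrE ?ltr0n ?ler_nat// (leq_trans _ mn).
Qed.

Lemma ln_le_sub1 (x : R) : 0 < x -> ln x <= x - 1.
Proof. by move=> x0; rewrite -{1}(subrKC 1 x) le_ln1Dx//; lra. Qed.

Lemma ln_ge_1subV (x : R) : 0 < x -> 1 - x^-1 <= ln x.
Proof.
move=> x0; have := @ln_le_sub1 x^-1; rewrite invr_gt0 => /(_ x0).
by rewrite lnV//; lra.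
Qed.

(** By monotonicity [n = 2] suffices, where [1 - 1 / x] equals [1 / 2]. The bound serves to absorb
    additive constants into multiples of [ln k]. *)
Lemma ln_nat_ge_half n : (1 < n)%N -> 2^-1 <= ln (n%:R : R).
Proof.
move=> n1; apply: le_trans (ln_nat_le n1).
by have := @ln_ge_1subV 2 (ltr0n R 2); lra.
Qed.

Lemma ln_nat_prod (I : Type) (r : seq I) (P : pred I) (F : I -> nat) :
  (forall i, 0 < F i)%N ->
  ln ((\prod_(i <- r | P i) F i)%:R : R) = \sum_(i <- r | P i) ln (F i)%:R.
Proof.
move=> F0; elim: r => [|i r IH]; first by rewrite !big_nil ln1.
rewrite !big_cons; case: ifP => // _.
by rewrite natrM lnM ?posrE ?ltr0n ?prodn_gt0// IH.
Qed.

(** Logarithm of the prime factorization. [N] is free so that the sum can stop at [k] for smooth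
    numbers. *)
Lemma ln_nat_logn N n : (0 < n)%N -> (forall p, prime p -> p %| n -> p < N)%N ->
  ln (n%:R : R) = \sum_(0 <= p < N | prime p) (logn p n)%:R * ln p%:R.
Proof.
move=> n0 nN; set M := maxn n N.
rewrite -{1}(partnT n0) (@widen_partn M) ?leq_maxl// ln_nat_prod; last first.
  by move=> p; rewrite pfactor_gt0.
rewrite (big_cat_nat _ (n := N))//=; last by rewrite leqW// leq_maxr.
have E p : ln ((p ^ logn p n)%N%:R : R) = (logn p n)%:R * ln p%:R.
  case: p => [|p]; first by rewrite lognE /= expn0 ln1 mul0r.
  by rewrite natrX lnXn ?ltr0n// mulr_natl.
rewrite [X in _ + X]big_nat_cond [X in _ + X]big1 ?addr0; last first.
  move=> p /andP[/andP[Np _] _]; rewrite E lognE; case: ifP => [/and3P[pp _ pn]|]; last first.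
    by rewrite mul0r.
  by have := nN p pp pn; rewrite ltnNge Np.
rewrite [RHS]big_mkcond; apply: eq_bigr => p _; rewrite E lognE.
by case: (prime p); rewrite ?mul0r.
Qed.

(** Taking the floor of a number that is at least 1 loses at most a factor of 2. *)
Lemma ge_half_divn p k : (0 < p <= k)%N -> k%:R / p%:R / 2 <= (k %/ p)%:R :> R.
Proof.
move=> /andP[p0 pk]; have q0 : (0 < k %/ p)%N by rewrite divn_gt0.
rewrite ler_pdivrMr// ler_pdivrMr ?ltr0n// -!natrM ler_nat.
have := divn_eq k p; have := ltn_pmod k p0; nia.
Qed.

Lemma ge_third_half n : (2 <= n)%N -> n%:R / 3 <= (n./2)%:R :> R.
Proof. by move=> n2; rewrite ler_pdivrMr// -natrM ler_nat; lia. Qed.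

Definition harm n : R := \sum_(1 <= i < n.+1) i%:R^-1.

Lemma harm_le n : (0 < n)%N -> harm n <= 1 + ln n%:R.
Proof.
elim: n => // -[_ _|n /(_ isT) IH _].
  by rewrite /harm big_nat1 ln1 invr1 addr0.
rewrite /harm big_nat_recr//=; apply: le_trans (lerD IH (lexx _)) _.
have := @ln_ge_1subV (n.+2%:R / n.+1%:R); rewrite divr_gt0 ?ltr0n// => /(_ isT).
rewrite ln_div ?posrE ?ltr0n// invf_div.
have -> : (n.+1%:R / n.+2%:R : R) = 1 - n.+2%:R^-1.
  have u0 : 0 < n.+1%:R :> R by rewrite ltr0n.
  rewrite -[n.+2]addn1 natrD; field; apply: lt0r_neq0; lra.
by move: (ln n.+2%:R) (ln n.+1%:R) (n.+2%:R^-1) => x y z; lra.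
Qed.

Lemma harm_ge n : ln n.+1%:R <= harm n.
Proof.
elim: n => [|n IH]; first by rewrite ln1 /harm big_geq.
rewrite /harm big_nat_recr//=; apply: le_trans (lerD IH (lexx _)).
have := @ln_le_sub1 (n.+2%:R / n.+1%:R); rewrite divr_gt0 ?ltr0n// => /(_ isT).
rewrite ln_div ?posrE ?ltr0n//.
have -> : (n.+2%:R / n.+1%:R : R) = 1 + n.+1%:R^-1.
  have u0 : 0 < n.+1%:R :> R by rewrite ltr0n.
  rewrite -[n.+2]addn1 natrD; field; apply: lt0r_neq0; lra.
by move: (ln n.+2%:R) (ln n.+1%:R) (n.+1%:R^-1) => x y z; lra.
Qed.

Lemma prime_dvd_fact p k : prime p -> (p %| k`!)%N -> (p <= k)%N.
Proof.
move=> pp; elim: k => [|k IH]; first by rewrite fact0 dvdn1 => /eqP p1; rewrite p1 in pp.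
rewrite factS Euclid_dvdM// => /orP[/dvdn_leq-> //|/IH]; exact: leqW.
Qed.

Lemma fact_leq_expn k : (k`! <= k ^ k)%N.
Proof.
elim: k => // k IH; rewrite factS expnS leq_mul2l /=.
apply: leq_trans IH _; case: k => // k; rewrite leq_exp2r// leqW.
Qed.

(** A weak form of Mertens' first theorem: in [ln k! <= k ln k], the first Legendre term
    [k %/ p >= k / 2p] of each exponent already gives the sum. *)
Lemma sum_ln_prime_div_le k : (0 < k)%N ->
  \sum_(0 <= p < k | prime p) ln p%:R / p%:R <= 2 * ln k%:R :> R.
Proof.
move=> k0.
have E : ln (k`!%:R : R) = \sum_(0 <= p < k.+1 | prime p) (logn p k`!)%:R * ln p%:R.
  apply: ln_nat_logn; first exact: fact_gt0.
  by move=> p pp /(prime_dvd_fact pp).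
have U : ln (k`!%:R : R) <= k%:R * ln k%:R.
  by rewrite mulr_natl -lnXn ?ltr0n// -natrX ln_nat_le// fact_leq_expn.
have L : k%:R / 2 * \sum_(0 <= p < k | prime p) ln p%:R / p%:R <= ln (k`!%:R : R).
  rewrite E big_mkcond [leRHS]big_mkcond big_nat_recr//= -big_mkcond mulr_sumr.
  rewrite ler_wpDr//; first by case: ifP => // _; rewrite mulr_ge0 ?ln_nat_ge0.
  rewrite -big_mkcond [leLHS]big_nat_cond [leRHS]big_nat_cond.
  apply: ler_sum => p /andP[/andP[_ pk] pp].
  have := @ge_half_divn p k; rewrite prime_gt0 // ltnW// => /(_ isT) h.
  have -> : k%:R / 2 * (ln p%:R / p%:R) = k%:R / p%:R / 2 * ln p%:R :> R by ring.
  apply: ler_wpM2r; first exact: ln_nat_ge0.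
  apply: le_trans h _; rewrite ler_nat logn_fact// big_ltn ?ltnS// expn1.
  exact: leq_addr.
have k0R : 0 < k%:R :> R by rewrite ltr0n.
by rewrite -(ler_pM2l (divr_gt0 k0R (ltr0n R 2))); apply: le_trans L _; lra.
Qed.
End NatLogarithm.

(** * Harmonic sums over smooth and rough numbers *)

Definition below (k : nat) : nat_pred := [pred p | p < k]%N.

Section SmoothRough.
Variables (R : realType) (k : nat).
Hypothesis k2 : (2 <= k)%N.

Local Notation smooth := (below k).-nat.
Local Notation rough := (below k)^'.-nat.

(** The sums [F(X)] and [S(X)] of the overview. *)
Definition smooth_harm (X : nat) : R := \sum_(1 <= s < X.+1 | smooth s) s%:R^-1.
Definition rough_harm (X : nat) : R := \sum_(1 <= r < X.+1 | rough r) r%:R^-1.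

Lemma smooth_harm_ge0 X : 0 <= smooth_harm X.
Proof. by apply: sumr_ge0 => s _; rewrite invr_ge0. Qed.

(** Only multiples [s = p q] contribute, with [logn p s = 1 + logn p q] and [q] smooth. So the sum
    [W] satisfies [W <= (F + W) / p], that is [W <= F / (p - 1)], and [p - 1 >= p / 2]. *)
Lemma sum_logn_smooth_le p X : prime p -> (p < k)%N ->
  \sum_(1 <= s < X.+1 | smooth s) (logn p s)%:R / s%:R
    <= 2 * smooth_harm X / p%:R.
Proof.
move=> pp pk; set W := \sum_(_ <= _ < _ | _) _.
have p0 := prime_gt0 pp; have p2 : 2 <= p%:R :> R by rewrite ler_nat prime_gt1.
have p0R : 0 < p%:R :> R by rewrite ltr0n.
suff WF : W <= (smooth_harm X + W) / p%:R.
  rewrite ler_pdivlMr//; rewrite ler_pdivlMr// in WF.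
  have W0 : 0 <= W by apply: sumr_ge0 => *; rewrite divr_ge0.
  by have := smooth_harm_ge0 X; nra.
rewrite {2}/W -big_split/= mulr_suml.
pose f s : R := (s%:R^-1 + (logn p s)%:R / s%:R) / p%:R.
have -> : W = \sum_(1 <= s < X.+1 | smooth s && (p %| s)%N) f (s %/ p)%N.
  rewrite [RHS]big_mkcondr /W [LHS]big_nat_cond [RHS]big_nat_cond.
  apply: eq_bigr => s /andP[/andP[s0 _] _].
  case: ifP => [ps|ps]; last by rewrite lognE ps andbF andbF mul0r.
  have [q sE] := dvdnP ps; rewrite sE in s0 *.
  have q0 : (0 < q)%N by case: q s0 {sE}.
  rewrite mulnK// lognM// (logn_prime p pp) eqxx /f natrD natrM.
  by rewrite mulrDl addrC invfM mulr1n mul1r mulrDl !mulrA.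
apply: ler_sum_inj; rewrite ?iota_uniq//.
- move=> s; rewrite !mem_index_iota => /andP[s1 sX] /andP[ss ps].
  rewrite divn_gt0// dvdn_leq//= ltnS (leq_trans (leq_div _ _))//=.
  exact: pnat_div.
- by move=> s t _ _ /andP[_ /divnK {2}<-] /andP[_ /divnK {2}<-] ->.
- by move=> s; rewrite mulr_ge0 ?invr_ge0// addr_ge0 ?invr_ge0// mulr_ge0 ?invr_ge0.
Qed.

(** Expanding [ln s] over the primes below [k] and exchanging the sums reduces this to the bounds
    for each prime. *)
Lemma sum_ln_smooth_le X :
  \sum_(1 <= s < X.+1 | smooth s) ln s%:R / s%:R <= 4 * ln k%:R * smooth_harm X.
Proof.
have -> : \sum_(1 <= s < X.+1 | smooth s) ln s%:R / s%:R =
    \sum_(0 <= p < k | prime p) ln p%:R *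
      (\sum_(1 <= s < X.+1 | smooth s) (logn p s)%:R / s%:R) :> R.
  under [RHS]eq_bigr do rewrite mulr_sumr.
  rewrite exchange_big/= big_nat_cond [RHS]big_nat_cond.
  apply: eq_bigr => s /andP[/andP[s0 _] ss].
  rewrite (@ln_nat_logn R k)//; last first.
    by move=> p pp ps; move/pnatP: ss => /(_ s0 p pp ps).
  rewrite mulr_suml; apply: eq_bigr => p _; ring.
apply: le_trans (_ : \sum_(0 <= p < k | prime p)
    (ln p%:R / p%:R) * (2 * smooth_harm X) <= _).
  rewrite big_nat_cond [leRHS]big_nat_cond.
  apply: ler_sum => p /andP[/andP[_ pk] pp].
  rewrite -mulrA ler_wpM2l ?ln_nat_ge0// mulrC; exact: sum_logn_smooth_le.
rewrite -mulr_suml; have := sum_ln_prime_div_le R (ltnW k2).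
by have := smooth_harm_ge0 X; move: (\sum_(_ <= _ < _ | _) _) => x; nra.
Qed.

Lemma smooth_harm_le X : smooth_harm X <= 20 * ln k%:R.
Proof.
set L := ln k%:R; have L2 : 2^-1 <= L := ln_nat_ge_half R k2.
have lnk8 : ln ((k ^ 8)%N%:R : R) = 8 * L.
  by rewrite natrX lnXn ?ltr0n ?(ltnW k2)// mulr_natl.
have H : harm R (k ^ 8) <= 1 + 8 * L.
  by rewrite -lnk8; apply: harm_le; rewrite expn_gt0 ltnW.
(* This gives [F <= 2 * harm (k ^ 8) <= 2 + 16 L], and [2 <= 4 L]. *)
suff : 8 * L * smooth_harm X <= 8 * L * harm R (k ^ 8) + 4 * L * smooth_harm X.
  by have := smooth_harm_ge0 X; nra.
apply: le_trans (lerD (lexx _) (sum_ln_smooth_le X)).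
have A : \sum_(1 <= s < X.+1 | smooth s && (s <= k ^ 8)%N) s%:R^-1 <= harm R (k ^ 8).
  rewrite /harm; apply: (@ler_sum_inj R _ _ _ _ _ xpredT id (fun s => s%:R^-1));
    rewrite ?iota_uniq// => s; last by rewrite invr_ge0.
  by rewrite !mem_index_iota => /andP[s1 _] /andP[_ ?]; rewrite s1 ltnS andbT.
have L0 : 0 <= 8 * L by lra.
apply: le_trans (lerD (ler_wpM2l L0 A) (lexx _)).
rewrite /smooth_harm !mulr_sumr [X in _ <= X + _]big_mkcondr -big_split/=.
(* Markov's inequality term by term: either [s <= k ^ 8] is counted in the harmonic sum, or
   [ln s >= 8 L]. *)
apply: ler_sum => s _; case: ifP => sk.
  by rewrite lerDl divr_ge0 ?ln_nat_ge0.
rewrite add0r ler_wpM2r ?invr_ge0// -lnk8 ln_nat_le// ltnW//.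
by rewrite ltnNge sk.
Qed.

(** Each [i <= X] is the product of its rough and smooth parts, both at most [X], and is determined
    by them; so [1 / i] is a term of the expanded product. *)
Lemma harm_le_rough_smooth X : harm R X <= rough_harm X * smooth_harm X.
Proof.
pose f (u : nat * nat) : R := u.1%:R^-1 * u.2%:R^-1.
pose t := [seq (r, s) | r <- [seq r <- index_iota 1 X.+1 | rough r],
                        s <- [seq s <- index_iota 1 X.+1 | smooth s]].
have -> : rough_harm X * smooth_harm X = \sum_(u <- t) f u.
  rewrite big_allpairs big_filter mulr_suml; apply: eq_bigr => r _.
  by rewrite big_filter mulr_sumr.
have -> : harm R X = \sum_(1 <= i < X.+1) f (i`_(below k)^', i`_(below k))%N.
  apply: eq_big_nat => i /andP[i0 _].
  by rewrite /f/= -invfM -natrM mulnC partnC.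
apply: ler_sum_inj.
- exact: iota_uniq.
- by apply: allpairs_uniq; rewrite ?filter_uniq ?iota_uniq// => -[? ?] [? ?].
- move=> i; rewrite mem_index_iota ltnS => /andP[i0 iX] _; rewrite andbT.
  have le pi : (i`_pi <= X)%N by rewrite (leq_trans _ iX)// dvdn_leq// dvdn_part.
  apply/allpairsP; exists (i`_(below k)^', i`_(below k))%N.
  by split; rewrite //= mem_filter part_pnat mem_index_iota part_gt0 ltnS le.
- move=> i j; rewrite !mem_index_iota => /andP[i0 _] /andP[j0 _] _ _ [E1 E2].
  by rewrite -(partnC (below k) i0) -(partnC (below k) j0) E1 E2.
- by move=> u; rewrite mulr_ge0 ?invr_ge0.
Qed.

Lemma ln_le_rough_harm X : ln X.+1%:R <= 20 * ln k%:R * rough_harm X.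
Proof.
apply: le_trans (harm_ge R X) _; apply: le_trans (harm_le_rough_smooth X) _.
rewrite mulrC ler_wpM2r ?smooth_harm_le//.
by apply: sumr_ge0 => r _; rewrite invr_ge0.
Qed.

End SmoothRough.

(** * Prime powers dividing central binomial coefficients *)

Lemma sum_leq_minn N e : (\sum_(1 <= a < N.+1) (a <= e) = minn N e)%N.
Proof.
elim: N => [|N IH]; first by rewrite big_geq ?min0n.
rewrite big_nat_recr//= IH; case: (ltnP N e) => /=; lia.
Qed.

Lemma sum_dvdn_expn_le p r N : prime p -> (0 < r)%N ->
  (\sum_(1 <= a < N.+1) (p ^ a %| r) <= logn p r)%N.
Proof.
move=> pp r0; under eq_bigr do rewrite pfactor_dvdn//.
by rewrite sum_leq_minn geq_minr.
Qed.

(** The exponent counts the [a >= 1] with [p ^ a <= M], so it is at most the integer logarithm of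
    [M] to base [p]. *)
Lemma expn_sum_leq p M N : prime p -> (0 < M)%N ->
  (p ^ (\sum_(1 <= a < N.+1) (p ^ a <= M)) <= M)%N.
Proof.
move=> pp M0; have p1 := prime_gt1 pp.
apply: leq_trans (trunc_logP p1 M0); rewrite leq_exp2l//.
apply: leq_trans (_ : \sum_(1 <= a < N.+1) (a <= trunc_log p M) <= _)%N; last first.
  by rewrite sum_leq_minn geq_minr.
apply: leq_sum => a _; case: (leqP (p ^ a) M) => // h; rewrite trunc_log_max//.
Qed.

Lemma logn_fact_widen p n N : prime p -> (n <= N)%N ->
  (logn p n`! = \sum_(1 <= a < N.+1) n %/ p ^ a)%N.
Proof.
move=> pp nN; rewrite logn_fact// [RHS](big_cat_nat _ (n := n.+1))//=.
rewrite [X in (_ + X)%N]big_nat_cond [X in (_ + X)%N]big1 ?addn0// => a /andP[/andP[na _] _].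
by rewrite divn_small// (ltn_trans na)// ltn_expl// prime_gt1.
Qed.

(** In Legendre's formula, [q = p ^ a] contributes [2n %/ q - 2 (n %/ q)], which is at most 1 and
    vanishes for [q > 2n]. *)
Lemma logn_central_bin_le p n N : prime p -> (n.*2 <= N)%N ->
  (logn p 'C(n.*2, n) <= \sum_(1 <= a < N.+1) (p ^ a <= n.*2))%N.
Proof.
move=> pp nN; have p1 := prime_gt1 pp.
have nn : (n <= n.*2)%N by rewrite -addnn leq_addr.
have := bin_fact nn; rewrite -{2}addnn addnK => /(congr1 (logn p)).
rewrite !lognM ?muln_gt0 ?fact_gt0 ?bin_gt0//.
rewrite (logn_fact_widen pp nN) (logn_fact_widen pp (leq_trans nn nN)) addnn.
move=> E; rewrite -(leq_add2r (\sum_(1 <= a < N.+1) n %/ p ^ a).*2) E.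
rewrite -[(\sum_(_ <= _ < _) _).*2]mul2n big_distrr -big_split/=; apply: leq_sum => a _.
have q0 : (0 < p ^ a)%N by rewrite expn_gt0 ltnW.
case: (leqP (p ^ a) n.*2) => [_|h]; last by rewrite divn_small// leq_addr.
have qn := ltn_pmod n q0; rewrite add1n -ltnS ltn_divLR//.
have := divn_eq n (p ^ a); nia.
Qed.

Lemma expn2_le_central_bin n : (2 ^ n <= 'C(n.*2, n))%N.
Proof.
elim: n => // n IH; rewrite expnS doubleS.
(* This says [C(2n+2, n+1) = 2 C(2n+1, n)], and [C(2n+1, n) >= C(2n, n)]. *)
have := mul_bin_diag n.*2.+2 n => /= E.
have := leq_bin2l n (leqnSn n.*2); nia.
Qed.

(** * Chebyshev-type lower bound for the number of rough integers *)

Section RoughCount.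
Variables (R : realType) (k : nat).
Hypothesis k2 : (2 <= k)%N.

Local Notation rough := (below k)^'.-nat.
Local Notation L := (ln (k%:R : R)).

(* Chebyshev's psi function at [M], restricted to primes [p >= k]; [N] only
   bounds the ranges of summation. *)
Definition rough_psi (N M : nat) : R :=
  \sum_(k <= p < N.+1 | prime p) \sum_(1 <= a < N.+1) (p ^ a <= M)%N%:R * ln p%:R.

Lemma rough_psi_ge0 N M : 0 <= rough_psi N M.
Proof.
by apply: sumr_ge0 => p _; apply: sumr_ge0 => a _; rewrite mulr_ge0 ?ln_nat_ge0.
Qed.

(** The prime power of each [p < k] in the coefficient is at most [2n], so these primes cost at most
    [k ln 2n]; the other primes are counted by [rough_psi]. *)
Lemma ln_central_bin_le n N : (n.*2 <= N)%N -> (0 < n)%N -> (k <= N)%N ->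
  ln ('C(n.*2, n)%:R : R) <= k%:R * ln (n.*2)%:R + rough_psi N n.*2.
Proof.
move=> nN n0 kN; have nn : (n <= n.*2)%N by rewrite -addnn leq_addr.
rewrite (@ln_nat_logn R N.+1) ?bin_gt0//; last first.
  move=> p pp pC; rewrite ltnS (leq_trans _ nN)//; apply: (prime_dvd_fact pp).
  by rewrite -(bin_fact nn) dvdn_mulr.
have le p : prime p -> (logn p 'C(n.*2, n))%:R * ln p%:R <=
    \sum_(1 <= a < N.+1) (p ^ a <= n.*2)%N%:R * ln p%:R :> R.
  move=> pp; rewrite -mulr_suml -natr_sum ler_wpM2r ?ln_nat_ge0// ler_nat.
  exact: logn_central_bin_le.
rewrite (big_cat_nat _ (n := k))//=; last exact: leqW.
apply: lerD; last by apply: ler_sum.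
rewrite -[k in k%:R]subn0 mulr_natl -sumr_const_nat.
rewrite big_mkcond; apply: ler_sum => p _; case: ifP => pp; last exact: ln_nat_ge0.
apply: le_trans (le p pp) _; rewrite -mulr_suml -natr_sum mulr_natl.
rewrite -lnXn ?ltr0n ?prime_gt0// -natrX ln_nat_le// expn_sum_leq// double_gt0//.
Qed.

(** With [n = y./2], the coefficient has logarithm at least [n / 2 >= y / 6]. The small primes cost
    at most [k ln y <= y / 24 + 6 k L], and [6 k L <= y / 24] by hypothesis. *)
Lemma rough_psi_ge N y : 144 * k%:R * L <= y%:R -> (y <= N)%N ->
  y%:R / 12 <= rough_psi N y.
Proof.
move=> hy yN; have L2 : 2^-1 <= L := ln_nat_ge_half R k2.
have k2R : 2 <= k%:R :> R by rewrite ler_nat.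
have y144 : 144 <= y%:R :> R by nra.
have ky : (k <= y)%N by rewrite -(ler_nat R); nra.
have y3 : (144 <= y)%N by rewrite -(ler_nat R).
pose n := y./2; have ny : (n.*2 <= y)%N by rewrite /n; lia.
have n0 : (0 < n)%N by rewrite /n; lia.
have yn : y%:R / 3 <= n%:R :> R.
  by apply: ge_third_half; apply: leq_trans y3.
have := ln_central_bin_le (leq_trans ny yN) n0 (leq_trans ky yN).
have C2 : n%:R / 2 <= ln ('C(n.*2, n)%:R : R).
  apply: le_trans (ln_nat_le R (expn2_le_central_bin n)).
  rewrite natrX lnXn ?ltr0n// mulr_natl.
  by rewrite -[X in X <= _]mulr_natl -[X in _ <= X]mulr_natl ler_wpM2l// ln_nat_ge_half.
have psi_le : rough_psi N n.*2 <= rough_psi N y.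
  apply: ler_sum => p _; apply: ler_sum => a _; rewrite ler_wpM2r ?ln_nat_ge0//.
  by rewrite ler_nat; case: (leqP (p ^ a) n.*2) => // h; rewrite (leq_trans h).
have ln2n := ln_nat_le R ny.
(* from ln z <= z - 1 at z = y / 24k *)
have lny : k%:R * ln (y%:R : R) <= y%:R / 24 + k%:R * (6 * L).
  have y0 : 0 < y%:R :> R by lra.
  have d0 : 0 < (24 * k)%N%:R :> R by rewrite ltr0n muln_gt0 (ltnW k2).
  have h := ln_le_sub1 (divr_gt0 y0 d0).
  rewrite ln_div ?posrE// in h.
  have h6 : ln ((24 * k)%N%:R : R) <= 6 * L.
    have -> : 6 * L = ln ((k ^ 6)%N%:R : R).
      by rewrite natrX lnXn ?ltr0n ?(ltnW k2)// mulr_natl.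
    apply: ln_nat_le; rewrite (expnSr k 5) leq_mul2r.
    by rewrite (@leq_trans (2 ^ 5)) ?orbT// leq_exp2r.
  have : k%:R * (y%:R / (24 * k)%N%:R) = y%:R / 24 :> R.
    by rewrite natrM; field; apply: lt0r_neq0; lra.
  by move: (y%:R / (24 * k)%N%:R) h h6 => z h h6; nra.
have : k%:R * ln (n.*2%:R : R) <= k%:R * ln y%:R by rewrite ler_wpM2l.
by move: (ln 'C(_, _)%:R) (ln n.*2%:R) (ln y%:R) C2 lny => u v w; lra.
Qed.

(** Multiplication by the rough number [d] sends the rough [r] with [d r <= N] injectively to rough
    multiples of [d] up to [N]. *)
Lemma sum_dvdn_rough_ge N d : rough d -> (d <= N)%N ->
  \sum_(1 <= r < N.+1 | rough r) (d <= N %/ r)%N%:R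
    <= \sum_(1 <= r < N.+1 | rough r) (d %| r)%N%:R :> R.
Proof.
move=> rd dN; have d0 : (0 < d)%N by case/andP: rd.
have mk (P : pred nat) (Q : pred nat) :
    \sum_(1 <= r < N.+1 | Q r) (P r)%:R = \sum_(1 <= r < N.+1 | Q r && P r) 1 :> R.
  by rewrite big_mkcondr; apply: eq_bigr => r _; case: (P r).
rewrite !mk.
apply: (@ler_sum_inj R _ _ _ _ _ _ (muln d) (fun=> 1)); rewrite ?iota_uniq//.
  move=> r; rewrite !mem_index_iota => /andP[r0 rN] /andP[rr].
  by rewrite leq_divRL// ltnS muln_gt0 d0 r0 pnatM rd rr dvdn_mulr// => ->.
by move=> r s _ _ _ _ /eqP; rewrite eqn_pmul2l// => /eqP.
Qed.

(** By von Mangoldt's identity, [ln r] is the sum of [ln p] over the prime powers [p ^ a] dividing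
    [r]. Those with [p >= k] are rough, so for each the rough [r] with [p ^ a <= N %/ r] are at most
    as many as its rough multiples. *)
Lemma sum_rough_psi_le N : (k <= N.+1)%N ->
  \sum_(1 <= r < N.+1 | rough r) rough_psi N (N %/ r)
    <= \sum_(1 <= r < N.+1 | rough r) ln r%:R.
Proof.
move=> kN.
apply: le_trans (_ : \sum_(1 <= r < N.+1 | rough r)
   \sum_(k <= p < N.+1 | prime p) \sum_(1 <= a < N.+1) (p ^ a %| r)%N%:R * ln p%:R <= _).
  rewrite exchange_big/= [leRHS]exchange_big/=.
  rewrite big_nat_cond [leRHS]big_nat_cond; apply: ler_sum => p /andP[/andP[kp _] pp].
  rewrite exchange_big/= [leRHS]exchange_big/=.
  apply: ler_sum => a _; rewrite -!mulr_suml ler_wpM2r ?ln_nat_ge0//.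
  have rp : rough (p ^ a)%N by rewrite pnatX pnatE// inE/= inE /= -leqNgt kp.
  have [paN|Npa] := leqP (p ^ a)%N N; first exact: sum_dvdn_rough_ge.
  rewrite big1 ?sumr_ge0// => r _.
  by rewrite leqNgt (leq_ltn_trans (leq_div _ _) Npa).
rewrite big_nat_cond [leRHS]big_nat_cond; apply: ler_sum => r /andP[/andP[r0 rN] rr].
rewrite (@ln_nat_logn R N.+1)//; last first.
  by move=> p pp /(dvdn_leq r0) pr; apply: leq_ltn_trans rN.
rewrite [leRHS](big_cat_nat _ (n := k))//= ler_wpDl//.
  by apply: sumr_ge0 => p _; rewrite mulr_ge0 ?ln_nat_ge0.
apply: ler_sum => p pp; rewrite -mulr_suml ler_wpM2r ?ln_nat_ge0//.
by rewrite -natr_sum ler_nat sum_dvdn_expn_le.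
Qed.

Definition rough_count (N : nat) : nat := count rough (iota 1 N).

Lemma sum_ln_rough_le N :
  \sum_(1 <= r < N.+1 | rough r) ln r%:R <= (rough_count N)%:R * ln N%:R :> R.
Proof.
rewrite /rough_count -sum1_count natr_sum mulr_suml /index_iota subSS subn0.
rewrite big_seq_cond [leRHS]big_seq_cond; apply: ler_sum => r.
by rewrite mem_iota add1n ltnS mul1r => /andP[/andP[_ rN] _]; apply: ln_nat_le.
Qed.

Lemma rough_harm_ge1 x : (0 < x)%N -> 1 <= rough_harm R k x.
Proof.
move=> x0; rewrite /rough_harm big_ltn_cond//= invr1 lerDl.
by apply: sumr_ge0 => r _; rewrite invr_ge0.
Qed.

Lemma rough_count_ln_ge N y : (0 < y <= N)%N -> (k <= N)%N ->
  144 * k%:R * L <= y%:R ->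
  N%:R / 24 * rough_harm R k (N %/ y) <= (rough_count N)%:R * ln N%:R.
Proof.
move=> /andP[y0 yN] kN hy.
apply: le_trans (sum_ln_rough_le N); apply: le_trans (sum_rough_psi_le (leqW kN)).
have xN : (N %/ y <= N)%N by apply: leq_div.
(* Only [r <= N %/ y] are kept: there [N %/ r >= y], so the linear bound on [rough_psi] applies. The
   floor turns [1 / 12] into [1 / 24]. *)
rewrite [leRHS](big_cat_nat _ (n := (N %/ y).+1))//= ler_wpDr//.
  by apply: sumr_ge0 => r _; apply: rough_psi_ge0.
rewrite /rough_harm mulr_sumr [leLHS]big_nat_cond [leRHS]big_nat_cond.
apply: ler_sum => r /andP[/andP[r0 rx] rr].
have yr : (y <= N %/ r)%N by rewrite leq_divRL// mulnC -leq_divRL.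
apply: le_trans (_ : (N %/ r)%:R / 12 <= _).
  have := @ge_half_divn R r N; rewrite r0 (leq_trans _ xN)// => /(_ isT).
  by move=> h; rewrite (mulrAC N%:R); move: (N%:R / r%:R) h => z; lra.
apply: rough_psi_ge; last exact: leq_div.
by apply: le_trans hy _; rewrite ler_nat.
Qed.

Lemma rough_count_ge N : 288 * k%:R * L <= N%:R ->
  N%:R <= 744 * L * (rough_count N)%:R.
Proof.
move=> hN; have L2 : 2^-1 <= L := ln_nat_ge_half R k2.
have k2R : 2 <= k%:R :> R by rewrite ler_nat.
have kN : (k <= N)%N by rewrite -(ler_nat R); nra.
have kL0 : 0 <= 144 * k%:R * L by nra.
(* Rounding up at most doubles the value, since [144 k L >= 1]. *)
pose y := (Num.truncn (144 * k%:R * L : R)).+1.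
have hy : 144 * k%:R * L <= y%:R by rewrite ltW// truncnS_gt.
have yle : y%:R <= 288 * k%:R * L.
  have : (Num.truncn (144 * k%:R * L))%:R <= 144 * k%:R * L by rewrite truncn_le.
  by rewrite /y -addn1 natrD; nra.
have yN : (0 < y <= N)%N by rewrite /= -(ler_nat R) (le_trans yle).
have := rough_count_ln_ge yN kN hy.
have x0 : (0 < N %/ y)%N by rewrite divn_gt0; case/andP: yN.
have S1 := rough_harm_ge1 x0.
have lnx := ln_le_rough_harm R k2 (N %/ y).
(* Indeed [y <= 288 k L <= 288 k ^ 2], and [288 < 2 ^ 9 <= k ^ 9]. *)
have lny : ln (y%:R : R) <= 11 * L.
  have -> : 11 * L = ln ((k ^ 11)%N%:R : R).
    by rewrite natrX lnXn ?ltr0n ?(ltnW k2)// mulr_natl.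
  apply: ln_nat_le; rewrite -(ler_nat R); apply: le_trans yle _.
  have Lk : L <= k%:R by rewrite ltW// ln_sublinear//; lra.
  have k9 : 512 <= k%:R ^+ 9 :> R.
    by rewrite -natrX (_ : 512 = (2 ^ 9)%N%:R) ?ler_nat ?leq_exp2r// natrX; ring.
  rewrite natrX (exprD _ 9 2) expr2; move: (k%:R ^+ 9) k9 => z k9.
  have kk : 4 <= k%:R * k%:R :> R by nra.
  by apply: le_trans (_ : 288 * (k%:R * k%:R) <= _); nra.
have lnN : ln (N%:R : R) <= ln y%:R + ln (N %/ y).+1%:R.
  rewrite -lnM ?posrE ?ltr0n// -natrM ln_nat_le// mulnC.
  by rewrite ltnW// -ltn_divLR.
(* Here [31 = 11 + 20], as the rough harmonic sum is at least 1. That sum then cancels from both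
   bounds, leaving [744 = 24 * 31]. *)
have S31 : ln (N%:R : R) <= 31 * L * rough_harm R k (N %/ y).
  by move: (ln N%:R) (ln y%:R) (ln (N %/ y).+1%:R) lnN lny lnx => u v w; nra.
have C0 : 0 <= (rough_count N)%:R :> R by [].
have S0 : 0 < rough_harm R k (N %/ y) by lra.
move=> /le_trans/(_ (ler_wpM2l C0 S31)) h.
have : rough_harm R k (N %/ y) * N%:R
    <= rough_harm R k (N %/ y) * (744 * L * (rough_count N)%:R) by lra.
by rewrite ler_pM2l.
Qed.

End RoughCount.

(** * Double counting of progressions and monochromatic pairs *)

Lemma size_le_of_rel (A B : eqType) (rho : A -> B -> Prop) (s : seq A) (t : seq B) :
  uniq s ->
  {in s, forall a, exists2 b, b \in t & rho a b} ->
  {in s &, forall a a', forall b, rho a b -> rho a' b -> a = a'} ->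
  (size s <= size t)%N.
Proof.
elim: s t => // a s IH t /= /andP[as_ us] st inj.
have [b bt rab] := st a (mem_head _ _).
(* Deleting the partner [b] of [a] from [t] leaves the partners of all other elements, because none
   of them is related to [b]. *)
have pt := perm_to_rem bt; rewrite (perm_size pt) /= ltnS; apply: IH => // [a' a's|].
  have [|b' b't rab'] := st a'; first by rewrite inE a's orbT.
  exists b' => //; move: b't; rewrite (perm_mem pt) inE => /orP[/eqP b'b|//].
  rewrite b'b in rab'; case/negP: as_.
  by rewrite (inj a a' _ _ b) ?inE ?eqxx ?a's ?orbT.
by move=> x y xs ys; apply: inj; rewrite inE ?xs ?ys orbT.
Qed.

Lemma below_nat k q : (0 < q < k)%N -> (below k).-nat q.
Proof.
move=> /andP[q0 qk]; apply/pnatP => // p _ /(dvdn_leq q0) pq.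
by rewrite inE /= (leq_ltn_trans pq).
Qed.

(** A positive factor below [k] is smooth, so both [d] and [d'] are the rough part of the common
    product. *)
Lemma rough_mul_inj k q q' d d' : (0 < q < k)%N -> (0 < q' < k)%N ->
  (below k)^'.-nat d -> (below k)^'.-nat d' -> (q * d = q' * d')%N -> d = d'.
Proof.
move=> qk q'k rd rd' E; have q0 : (0 < q)%N by case/andP: qk.
have d0 : (0 < d)%N by case/andP: rd.
have d'0 : (0 < d')%N by case/andP: rd'.
have := congr1 (fun n => n`_(below k)^')%N E.
rewrite !partnM//; last by case/andP: q'k.
rewrite !(part_pnat_id rd, part_pnat_id rd') !part_p'nat ?mul1n//;
  by rewrite pnatNK below_nat.
Qed.

Section NoRainbow.
Variables (k t m : nat) (col : nat -> 'I_t).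
Hypotheses (k2 : (2 <= k)%N) (col_eq : equinumerous m col).

(** The pairs are ordered and include [x = y], so each of the [t m] points has exactly [m]
    partners. *)
Lemma size_monochromatic_pairs :
  size [seq (x, y) | x <- interval1 (t * m),
                     y <- [seq y <- interval1 (t * m) | col y == col x]]
    = (t * m * m)%N.
Proof.
rewrite size_allpairs_dep sumnE big_map.
under eq_bigr do rewrite size_filter col_eq.
by rewrite big_const_seq count_predT size_iota iter_addn_0 mulnC.
Qed.

Lemma no_rainbow_rough_count_le N : (N * (2 * k) <= t * m)%N ->
  (forall s, is_AP_in k (t * m) s -> ~ rainbow col s) ->
  ((t * m)./2 * rough_count k N <= t * m * m * k)%N.
Proof.
move=> Nn norb; set n := (t * m)%N.
pose A := [seq (a, d) | a <- iota 1 n./2, d <- [seq d <- iota 1 N | (below k)^'.-nat d]].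
have <- : size A = (n./2 * rough_count k N)%N.
  by rewrite size_allpairs size_iota size_filter.
pose B := [seq (u, i) | u <- [seq (x, y) | x <- interval1 (t * m),
                     y <- [seq y <- interval1 (t * m) | col y == col x]], i <- iota 0 k].
have <- : size B = (n * m * k)%N.
  by rewrite size_allpairs size_monochromatic_pairs size_iota.
(* The index [i] is recorded to recover [a = x - i d]; [j] stays existential because [d] is read off
   from [y - x]. *)
pose rho (ad : nat * nat) (b : nat * nat * nat) :=
  exists2 j, (b.2 < j < k)%N & b.1 = (ad.1 + b.2 * ad.2, ad.1 + j * ad.2)%N.
have AE ad : ad \in A -> [/\ (0 < ad.1 <= n./2)%N, (0 < ad.2 <= N)%N & (below k)^'.-nat ad.2].
  move=> /allpairsP[[a d] /= [+ + ->]] /=; rewrite mem_filter !mem_iota !add1n !ltnS.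
  by move=> -> /andP[-> ->].
apply: (@size_le_of_rel _ _ rho).
- by apply: allpairs_uniq; rewrite ?filter_uniq ?iota_uniq// => -[? ?] [? ?].
- move=> [a d] /AE[/= /andP[a0 an] /andP[d0 dN] rd].
  have sub i : (i < k)%N -> (a + i * d)%N \in interval1 n.
    move=> ik; rewrite mem_iota add1n ltnS; apply/andP; split; first lia.
    (* Since [2 k N <= n], the offset is at most [n / 2], as is [a]. *)
    have : (i * d <= k * N)%N by rewrite leq_mul// ltnW.
    by rewrite -/n in Nn; lia.
  have [i [j [ij jk cij]]] : exists i j, [/\ i < j, j < k & col (a + i * d) = col (a + j * d)]%N.
    apply: contrapT => H; apply: (norb (arith_prog k a d)).
      exists a, d; split=> // x /mapP[i]; rewrite mem_iota => /= ik ->; exact: sub.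
    move=> x y /mapP[i]; rewrite mem_iota => /= ik -> /mapP[j]; rewrite mem_iota => /= jk -> c.
    have [ij|ji|->//] := ltngtP i j; exfalso; apply: H; first by exists i, j.
    by exists j, i.
  have ik := ltn_trans ij jk.
  exists ((a + i * d, a + j * d)%N, i); last by exists j => //=; rewrite ij.
  apply/allpairsP; exists ((a + i * d, a + j * d)%N, i); split=> //=; last by rewrite mem_iota.
  apply/allpairsPdep; exists (a + i * d)%N, (a + j * d)%N; split=> //; first exact: sub.
  by rewrite mem_filter cij eqxx sub.
- move=> [a d] [a' d'] /AE[/= _ _ rd] /AE[/= _ _ rd'] [[x y] i].
  move=> [j /= /andP[ij jk] [xE yE]] [j' /= /andP[ij' jk'] [xE' yE']].
  have dd : d = d'.
    apply: (@rough_mul_inj k (j - i) (j' - i)) => //; first lia; first lia.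
    by rewrite !mulnBl; lia.
  by rewrite dd in xE; congr pair => //; lia.
Qed.
End NoRainbow.

(** * The bound on the number of colors *)

Lemma le_of_counting (R : realType) (n h m k L N C : R) :
  0 < n -> 0 <= k -> 0 <= L -> 0 <= C ->
  n <= 4 * k * N -> N <= 744 * L * C -> n / 3 <= h -> h * C <= n * m * k ->
  n <= 8928 * k ^+ 2 * L * m.
Proof.
move=> n0 k0 L0 C0 nN NC nh hC.
(* [2976 = 4 * 744]; the factor 3 from [n / 3 <= h] then gives [8928 = 3 * 2976]. *)
have nC : n <= 2976 * (k * L) * C.
  have k40 : 0 <= 4 * k by rewrite mulr_ge0.
  by apply: le_trans nN _; apply: le_trans (ler_wpM2l k40 NC) _; lra.
have h1 : n / 3 * n <= n / 3 * (2976 * (k * L) * C) by apply: ler_wpM2l nC; lra.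
have h2 : n / 3 * C <= n * m * k by apply: le_trans hC; apply: ler_wpM2r.
have kL0 : 0 <= 2976 * (k * L) by rewrite !mulr_ge0.
have h3 := ler_wpM2l kL0 h2.
have : n * n <= n * (8928 * k ^+ 2 * L * m) by rewrite expr2; clear -h1 h3; lra.
by rewrite ler_pM2l.
Qed.

Lemma forces_rainbow_AP_large (R : realType) k t : (2 <= k)%N ->
  8928 * k%:R ^+ 2 * ln k%:R < t%:R :> R -> forces_rainbow_AP k t.
Proof.
move=> k2 ht m m0 col col_eq; apply: contrapT => H.
have norb s : is_AP_in k (t * m) s -> ~ rainbow col s by move=> sAP sr; apply: H; exists s.
set L := ln k%:R in ht; have L2 : 2^-1 <= L := ln_nat_ge_half R k2.
have k2R : 2 <= k%:R :> R by rewrite ler_nat.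
pose n := (t * m)%N; pose N := (n %/ (2 * k))%N.
have tn : t%:R <= n%:R :> R by rewrite ler_nat leq_pmulr.
have kL : 1 <= k%:R * L by nra.
have kkL : k%:R ^+ 2 * L = k%:R * (k%:R * L) by rewrite expr2 mulrA.
have kn : (2 * k <= n)%N by rewrite -(ler_nat R) natrM; nra.
have nN : n%:R <= 4 * k%:R * N%:R :> R.
  have := @ge_half_divn R (2 * k) n; rewrite kn muln_gt0/= (ltnW k2) => /(_ isT).
  rewrite -/N !ler_pdivrMr ?ltr0n ?muln_gt0 ?(ltnW k2)// natrM; lra.
(* After multiplication by [4 k] the left side is [1152 k ^ 2 L], below [8928 k ^ 2 L < t <= n]. *)
have hN : 288 * k%:R * L <= N%:R.
  have k0 : 0 < 4 * k%:R :> R by lra.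
  rewrite -(ler_pM2l k0); apply: le_trans nN; nra.
have cN := rough_count_ge k2 hN.
have := no_rainbow_rough_count_le k2 col_eq (leq_divM _ _) norb.
rewrite -/n -/N -(ler_nat R) (natrM _ n./2) (natrM _ _ k) (natrM _ n) => hc.
have n3 : n%:R / 3 <= (n./2)%:R :> R.
  by apply: ge_third_half; apply: leq_trans kn; rewrite -[2%N]muln1 leq_mul// ltnW.
have n0 : 0 < n%:R :> R by apply: lt_le_trans tn; apply: le_lt_trans ht; nra.
have := le_of_counting n0 (ler0n R k) (le_trans _ L2) (ler0n R _) nN cN n3 hc.
rewrite invr_ge0 ler0n => /(_ isT).
by rewrite /n natrM ler_pM2r ?ltr0n// leNgt ht.
Qed.

Lemma forces_rainbow_AP_least k t : (0 < t)%N -> forces_rainbow_AP k t ->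
  exists2 T, is_T k T & (T <= t)%N.
Proof.
(* Classical reflection supplies the boolean predicate that [ex_minnP] minimizes; positivity is part
   of it, which excludes the vacuous case [u = 0]. *)
move=> t0 ft; pose P u := `[< (0 < u)%N /\ forces_rainbow_AP k u >].
have exP : exists u, P u by exists t; apply/asboolP.
case: (ex_minnP exP) => T /asboolP[T0 fT] Tmin; exists T; last by apply/Tmin/asboolP.
by split=> // u u0 fu; apply/Tmin/asboolP.
Qed.

Theorem corollary4 (R : realType) :
  exists c : R, 0 < c /\
    forall k : nat, (2 <= k)%N ->
      exists T : nat, is_T k T /\ T%:R <= c * k%:R ^+ 2 * ln k%:R.
Proof.
have [c c0 forces] : exists2 c : R, 0 < c & forall k t, (2 <= k)%N ->
    c * k%:R ^+ 2 * ln k%:R < t%:R -> forces_rainbow_AP k t.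
  by exists 8928; [rewrite ltr0n | exact: forces_rainbow_AP_large].
(* The extra 1 pays for rounding [x] up to an integer, as [k ^ 2 ln k >= 4 / 2 >= 1]. *)
exists (c + 1); split; first exact: addr_gt0.
move=> k k2; set x := c * k%:R ^+ 2 * ln k%:R.
have L2 : 2^-1 <= ln (k%:R : R) := ln_nat_ge_half R k2.
have k4 : 4 <= k%:R ^+ 2 :> R by rewrite -natrX ler_nat (@leq_exp2r 2 k 2).
have x0 : 0 <= x by rewrite !mulr_ge0 ?ln_nat_ge0 ?exprn_ge0// ltW.
have ft : forces_rainbow_AP k (Num.truncn x).+1 by apply: forces; rewrite ?truncnS_gt.
have [T TT Tle] := forces_rainbow_AP_least (ltn0Sn _) ft.
exists T; split=> //; apply: le_trans (_ : (Num.truncn x).+1%:R <= _).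
  by rewrite ler_nat.
rewrite -addn1 natrD !mulrDl mul1r lerD ?truncn_le//.
by clear -L2 k4; nra.
Qed.
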